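(* Let $C:f=0$ be a reduced curve of degree $d$ in $X=\mathbb{P}^2$ over $\mathbb{C}$ with $\mathrm{mdr}(f)\ge 1$. For any line $L:\alpha_L=0$ in $X$, one has $$d_1^L=\min\{\mathrm{mdr}(f),\,k(f,L)\},$$ where $$k(f,L)=\min\{k\in\mathbb{N}\ :\ N(f)_{k+d-2}\xrightarrow{\ \cdot\alpha_L\ }N(f)_{k+d-1}\ \text{is not injective}\}.$$
   Context: $S=\mathbb{C}[x,y,z]$ with the usual grading; $f\in S_d$ is the reduced homogeneous equation of $C$; $f_x,f_y,f_z$ are its partial derivatives. $AR(f)\subset S^3$ is the graded $S$-module with $AR(f)_k=\{(a,b,c)\in S_k^3: af_x+bf_y+cf_z=0\}$ and $\mathrm{mdr}(f)=\min\{k: AR(f)_k\neq 0\}$. $E_C=\widetilde{AR(f)}$ is the associated rank two vector bundle on $X$. For a line $L$, the integers $d_1^L\le d_2^L$ are defined by $E_C|_L\simeq\mathcal{O}_L(-d_1^L)\oplus\mathcal{O}_L(-d_2^L)$. $J_f=(f_x,f_y,f_z)$ is the Jacobian ideal, $\widehat{J}_f$ its saturation with respect to $(x,y,z)$, and $N(f)=\widehat{J}_f/J_f$ the graded Jacobian module. Here $0\in\mathbb{N}$, and $k(f,L)=+\infty$ if the set defining it is empty. *)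

(* Defs.v *)
From HB Require Import structures.
(* mpoly has to come before constructive_ereal: the two files reserve a common
   notation level in a way that only works in this order. *)
From mathcomp Require Import all_boot all_order all_algebra.
From mathcomp Require Import mpoly.
From mathcomp Require Import boolp constructive_ereal reals complex.

Set Implicit Arguments.
Unset Strict Implicit.
Unset Printing Implicit Defensive.

Import Order.TTheory GRing.Theory Num.Theory.
Local Open Scope ring_scope.

(* The coordinate ring S = K[x, y, z] of the projective plane. *)
Notation poly3 K := {mpoly K[3]}.

(* Degrees range over int, so that twists are unrestricted; S_j = 0 for j < 0. *)
Definition homogz (K : fieldType) (j : int) (p : poly3 K) : Prop :=
  if j is Posz n then p \is n.-homog else p = 0.

(* Minimum of a set of naturals, +oo when the set is empty. *)
Definition min_nat (P : nat -> Prop) : \bar int :=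
  if pselect (exists n, `[< P n >]) is left exP then (ex_minn exP)%:Z%:E
  else +oo%E.

(* A graded S-module, presented as the subquotient
     (+)_j  piece j / null j
   of an ambient S-module: an element of degree j is represented by a vector of
   piece j, and two such vectors are identified when they differ by a vector of
   null j.  *)
Record grmod (K : fieldType) := GrMod {
  ambient :> lmodType (poly3 K);
  piece : int -> ambient -> Prop;
  null : int -> ambient -> Prop;
  null_piece : forall j v, null j v -> piece j v;
  null0 : forall j, null j 0;
  nullB : forall j u v, null j u -> null j v -> null j (u - v);
  pieceB : forall j u v, piece j u -> piece j v -> piece j (u - v);
  nullZ : forall i j a v, a \is i.-homog -> null j v -> null (i%:Z + j) (a *: v);
  pieceZ : forall i j a v, a \is i.-homog -> piece j v -> piece (i%:Z + j) (a *: v)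
}.

(* Multiplication by a linear form, M_j -> M_(j+1), is injective. *)
Definition mul_injective (K : fieldType) (M : grmod K) (alpha : poly3 K)
    (j : int) : Prop :=
  forall u v : M, piece j u -> piece j v ->
    null (j + 1) (alpha *: u - alpha *: v) -> null j (u - v).

Local Obligation Tactic := idtac.

Section BasicModules.
Variable K : fieldType.
Implicit Types (p q a f alpha : poly3 K) (i j : int).

Lemma homogz0 j : homogz j (0 : poly3 K).
Proof. by case: j => n //=; exact: dhomog0. Qed.

Lemma homogzB j p q : homogz j p -> homogz j q -> homogz j (p - q).
Proof.
by case: j => n /=; [exact: rpredB | move=> -> ->; rewrite subr0].
Qed.

Lemma homogzM (i : nat) j a p :
  a \is i.-homog -> homogz j p -> homogz (i%:Z + j) (a * p).
Proof.
move=> ha; case: j => n hp /=; first exact: dhomogM.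
by rewrite hp mulr0; apply: homogz0.
Qed.

(* The twisted free module S(-e), with S(-e)_j = S_(j-e). *)
Program Definition twist (e : int) : grmod K :=
  @GrMod K (poly3 K)^o (fun j p => homogz (j - e) p) (fun _ p => p = 0)
    _ _ _ _ _ _.
Next Obligation. by move=> e j p ->; exact: homogz0. Qed.
Next Obligation. by []. Qed.
Next Obligation. by move=> e j p q -> ->; rewrite subr0. Qed.
Next Obligation. by move=> e j p q; exact: homogzB. Qed.
Next Obligation. by move=> e i j a p _ ->; rewrite scaler0. Qed.
Next Obligation. by move=> e i j a p ha hp; rewrite /= -addrA; apply: homogzM. Qed.

Program Definition dsum (M N : grmod K) : grmod K :=
  @GrMod K (M * N)%type (fun j v => piece j v.1 /\ piece j v.2)
    (fun j v => null j v.1 /\ null j v.2) _ _ _ _ _ _.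
Next Obligation. by move=> M N j v [? ?]; split; apply: null_piece. Qed.
Next Obligation. by move=> M N j; split; apply: null0. Qed.
Next Obligation. by move=> M N j u v [? ?] [? ?]; split; apply: nullB. Qed.
Next Obligation. by move=> M N j u v [? ?] [? ?]; split; apply: pieceB. Qed.
Next Obligation. by move=> M N i j a v ? [? ?]; split; apply: nullZ. Qed.
Next Obligation. by move=> M N i j a v ? [? ?]; split; apply: pieceZ. Qed.

(* M / alpha M(-1), for a linear form alpha.  The associated sheaf is the
   restriction to the line alpha = 0 of the sheaf associated with M. *)
Program Definition restr alpha (M : grmod K) : grmod K :=
  @GrMod K M (@piece K M)
    (fun j v => piece j v /\
       exists2 w, piece (j - 1) w & null j (v - alpha *: w)) _ _ _ _ _ _.
Next Obligation. by move=> alpha M j v []. Qed.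
Next Obligation.
move=> alpha M j.
have p0 k : piece k (0 : M) by apply: null_piece; apply: null0.
by split=> //; exists 0; rewrite // scaler0 subr0; apply: null0.
Qed.
Next Obligation.
move=> alpha M j u v [pu [x px nx]] [pv [y py ny]].
split; first exact: pieceB.
exists (x - y); first exact: pieceB.
have -> : u - v - alpha *: (x - y) = (u - alpha *: x) - (v - alpha *: y).
  by rewrite scalerBr !opprB addrACA [RHS]addrACA (addrC (- v)).
exact: nullB.
Qed.
Next Obligation. by move=> alpha M j u v; exact: pieceB. Qed.
Next Obligation.
move=> alpha M i j a v ha [pv [w pw nw]].
split; first exact: pieceZ.
exists (a *: w); first by rewrite -addrA; apply: pieceZ.
rewrite scalerA mulrC -scalerA -scalerBr; exact: nullZ.
Qed.
Next Obligation. by move=> alpha M i j a v; exact: pieceZ. Qed.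

End BasicModules.

Section Sheaves.
Variable K : fieldType.
Implicit Types (M N : grmod K) (g h : poly3 K).

(* The sheaf associated with M is described on the basis of principal opens
   D(g), g <> 0 homogeneous of positive degree, which is stable under finite
   intersections since D(g) and D(h) meet in D(g * h).  The sections on D(g) are
   the degree 0 part of the localization M_g; the pair (v, n) stands for the
   fraction v / g^n with v of degree n deg g. *)
Definition pdeg g : nat := (msize g).-1.

Definition principal g : Prop :=
  [/\ g != 0, (0 < pdeg g)%N & g \is (pdeg g).-homog].

Definition is_section M g (s : M * nat) : Prop :=
  piece (s.2 * pdeg g)%N%:Z s.1.

Definition eq_section M g (s t : M * nat) : Prop :=
  exists k : nat, null ((k + (s.2 + t.2)) * pdeg g)%N%:Z
    (g ^+ k *: (g ^+ t.2 *: s.1 - g ^+ s.2 *: t.1)).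

Definition add_section M g (s t : M * nat) : M * nat :=
  (g ^+ t.2 *: s.1 + g ^+ s.2 *: t.1, (s.2 + t.2)%N).

(* The pair (a, n) stands for the section a / g^n of the structure sheaf. *)
Definition is_function g (c : poly3 K * nat) : Prop :=
  c.1 \is (c.2 * pdeg g)%N.-homog.

Definition scale_section M (c : poly3 K * nat) (s : M * nat) : M * nat :=
  (c.1 *: s.1, (c.2 + s.2)%N).

(* Restriction from D(g) to D(g * h): v / g^n = (h^n v) / (g h)^n. *)
Definition res_section M h (s : M * nat) : M * nat :=
  (h ^+ s.2 *: s.1, s.2).

(* Morphisms of sheaves of modules over the structure sheaf of the plane. *)
Record sheaf_hom M N (phi : poly3 K -> M * nat -> N * nat) : Prop := SheafHom {
  hom_section : forall g s, principal g -> is_section g s ->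
    is_section g (phi g s);
  hom_eq : forall g s t, principal g -> is_section g s -> is_section g t ->
    eq_section g s t -> eq_section g (phi g s) (phi g t);
  hom_add : forall g s t, principal g -> is_section g s -> is_section g t ->
    eq_section g (phi g (add_section g s t)) (add_section g (phi g s) (phi g t));
  hom_scale : forall g c s, principal g -> is_function g c -> is_section g s ->
    eq_section g (phi g (scale_section c s)) (scale_section c (phi g s));
  hom_res : forall g h s, principal g -> principal h -> is_section g s ->
    eq_section (g * h) (phi (g * h) (res_section h s))
                       (res_section h (phi g s))
}.

Definition sheaf_iso M N : Prop :=
  exists phi psi, [/\ sheaf_hom (M := M) (N := N) phi,
    sheaf_hom (M := N) (N := M) psi,
    forall g s, principal g -> is_section g s ->
      eq_section g (psi g (phi g s)) s &
    forall g t, principal g -> is_section g t ->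
      eq_section g (phi g (psi g t)) t].

End Sheaves.

Section Curve.
Variable K : fieldType.
Implicit Types (f g p q alpha : poly3 K).

(* S / (f) has no nonzero nilpotent element. *)
Definition reduced f : Prop :=
  forall g (n : nat), (exists h, g ^+ n = h * f) -> exists h, g = h * f.

Definition dotgrad f (v : 'rV[poly3 K]_3) : poly3 K :=
  \sum_(i < 3) v 0 i * f^`M(i).

Lemma dotgrad_is_linear f : linear (dotgrad f : _ -> (poly3 K)^o).
Proof.
move=> a u v; rewrite /dotgrad scaler_sumr -big_split /=.
by apply: eq_bigr => i _; rewrite !mxE mulrDl -mulrA.
Qed.
HB.instance Definition _ f :=
  GRing.isLinear.Build (poly3 K) 'rV[poly3 K]_3 (poly3 K)^o _ (dotgrad f)
    (dotgrad_is_linear f).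

Program Definition AR f : grmod K :=
  @GrMod K 'rV[poly3 K]_3
    (fun k v => (forall i, homogz k (v 0 i)) /\ dotgrad f v = 0)
    (fun _ v => v = 0) _ _ _ _ _ _.
Next Obligation.
by move=> f j v ->; split; [move=> i; rewrite mxE; apply: homogz0 | rewrite linear0].
Qed.
Next Obligation. by []. Qed.
Next Obligation. by move=> f j u v -> ->; rewrite subr0. Qed.
Next Obligation.
move=> f j u v [hu eu] [hv ev]; split; last by rewrite linearB /= eu ev subr0.
by move=> i; rewrite !mxE; apply: homogzB.
Qed.
Next Obligation. by move=> f i j a v _ ->; rewrite scaler0. Qed.
Next Obligation.
move=> f i j a v ha [hv ev]; split; last by rewrite linearZ /= ev scaler0.
by move=> l; rewrite mxE; apply: homogzM.
Qed.

Definition jacobian f p : Prop := exists v, p = dotgrad f v.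

(* Saturation with respect to (x, y, z), whose n-th power is generated, as an
   additive group, by the forms of degree at least n. *)
Definition jacobian_sat f p : Prop :=
  exists n : nat, forall (m : nat) q, (n <= m)%N -> q \is m.-homog ->
    jacobian f (q * p).

Lemma jacobianB f p q : jacobian f p -> jacobian f q -> jacobian f (p - q).
Proof. by move=> [u ->] [v ->]; exists (u - v); rewrite linearB /=. Qed.

Lemma jacobianM f q p : jacobian f p -> jacobian f (q * p).
Proof. by move=> [u ->]; exists (q *: u); rewrite linearZ. Qed.

Lemma jacobian_satB f p q :
  jacobian_sat f p -> jacobian_sat f q -> jacobian_sat f (p - q).
Proof.
move=> [n hn] [m hm]; exists (n + m)%N => l r le_l hr; rewrite mulrBr.
apply: jacobianB; [apply: hn hr | apply: hm hr].
  exact: leq_trans (leq_addr _ _) le_l.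
exact: leq_trans (leq_addl _ _) le_l.
Qed.

(* N(f), the quotient of the saturated Jacobian ideal by the Jacobian ideal. *)
Program Definition jacobian_module f : grmod K :=
  @GrMod K (poly3 K)^o
    (fun j p => homogz j p /\ jacobian_sat f p)
    (fun j p => homogz j p /\ jacobian f p) _ _ _ _ _ _.
Next Obligation.
by move=> f j p [hp Jp]; split=> //; exists 0%N => m q _ _; apply: jacobianM.
Qed.
Next Obligation.
by move=> f j; split; [exact: homogz0 | exists 0; rewrite linear0].
Qed.
Next Obligation.
by move=> f j p q [? ?] [? ?]; split; [exact: homogzB | exact: jacobianB].
Qed.
Next Obligation.
by move=> f j p q [? ?] [? ?]; split; [exact: homogzB | exact: jacobian_satB].
Qed.
Next Obligation.
by move=> f i j a p ha [? ?]; split; [exact: homogzM | exact: jacobianM].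
Qed.
Next Obligation.
move=> f i j a p ha [? [n hn]]; split; first exact: homogzM.
by exists n => m q le_nm /hn Jqp; rewrite /GRing.scale /= mulrCA; apply: jacobianM; exact: Jqp.
Qed.

Definition mdr f : \bar int :=
  min_nat (fun k => exists v : AR f, piece k%:Z v /\ ~ null k%:Z v).

(* d is the degree of f. *)
Definition k_line (d : nat) f alpha : \bar int :=
  min_nat (fun k =>
    ~ mul_injective (jacobian_module f) alpha (k%:Z + d%:Z - 2)).

(* d1 <= d2 are the integers with E_C|_L = O_L(-d1) (+) O_L(-d2), where E_C is
   the sheaf associated with AR(f) and L is the line alpha = 0.  Sheaves on L are
   regarded as sheaves on the plane, by direct image; this functor is fully
   faithful. *)
Definition splitting_type f alpha (d1 d2 : int) : Prop :=
  d1 <= d2 /\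
  sheaf_iso (restr alpha (AR f))
            (dsum (restr alpha (twist K d1)) (restr alpha (twist K d2))).

End Curve.

(* Main.v *)
(* Write M for AR(f) / alpha AR(f)(-1) and, in coordinates adapted to the line L,
   let alpha, X_j, X_l be the three linear forms.  A section of E_C|_L (k) is a
   pair v / X_j^n, w / X_l^m of fractions of degree k over M that agree on the
   overlap.  On the side of O_L(-d1) (+) O_L(-d2) a nonzero pair exists for
   k = d1 and for no k < d1.  On the side of AR(f), agreement modulo alpha forces
   v = X_j^n r and w = X_l^m r modulo alpha for one vector r of degree k, since
   X_j, X_l is a regular sequence modulo alpha.  Then r . grad f = alpha p, and
   X_j^n p, X_l^m p, alpha p all lie in J_f, so that p is in the saturation of
   J_f.  If p = r' . grad f is in J_f, then r - alpha r' is a syzygy of degree k;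
   otherwise p is a nonzero element of N(f)_(k+d-2) killed by alpha.  Both
   constructions can be reversed. *)
Require Import Defs.
From HB Require Import structures.
From mathcomp Require Import all_boot all_order all_algebra.
From mathcomp Require Import ring zify.
From mathcomp Require Import mpoly.
From mathcomp Require Import boolp constructive_ereal reals complex.
Import Order.TTheory GRing.Theory Num.Theory.
Local Open Scope ring_scope.
Set Implicit Arguments.
Unset Strict Implicit.

(** * Homogeneous components with integer degrees, and divisibility by powers of a variable *)

Section Homogeneous.
Variable K : fieldType.
Implicit Types (p q a : poly3 K) (i : nat) (j : int).

(** Component of degree [j], zero for negative [j]; it serves to replace arbitrary cofactors by
    homogeneous ones. *)
Definition pihomogz j p : poly3 K :=
  if j is Posz n then pihomog mdeg n p else 0.

Lemma homogz_lt0 n (x : poly3 K) : n < 0 -> homogz n x -> x = 0.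
Proof. by case: n. Qed.

Lemma pihomogzP j p : homogz j (pihomogz j p).
Proof. by case: j => n //=; exact: pihomogP. Qed.

Lemma pihomogz_id j p : homogz j p -> pihomogz j p = p.
Proof. by case: j => n /=; [exact: pihomog_dE | move=> ->]. Qed.

Lemma pihomogz_dhomog j i p :
  p \is i.-homog -> pihomogz j p = if j == i then p else 0.
Proof.
case: j => n hp //=; case: eqP => [[->]|ne]; first exact: pihomog_dE.
by apply: pihomog_ne0 hp; apply/eqP => e; apply: ne; rewrite e.
Qed.

Lemma pihomogzD j : {morph pihomogz j : p q / p + q}.
Proof. by case: j => n p q /=; rewrite ?pihomogD ?addr0. Qed.

(** Both sides are additive in [p], so it suffices to treat a monomial, whose product with [a] is
    again homogeneous. *)
Lemma pihomogzM i j a p :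
  a \is i.-homog -> pihomogz (i%:Z + j) (a * p) = a * pihomogz j p.
Proof.
move=> ha; elim/mpolyind: p => [|c m p _ _ IH].
  have z k : pihomogz k 0 = 0 by apply: pihomogz_id; exact: homogz0.
  by rewrite mulr0 !z mulr0.
have hm : c *: 'X_[m] \is (mdeg m).-homog for [measure of mdeg].
  by rewrite dhomogZ // dhomogX.
rewrite mulrDr !pihomogzD IH mulrDr; congr (_ + _).
rewrite (pihomogz_dhomog _ hm) (pihomogz_dhomog _ (dhomogM ha hm)) PoszD.
by rewrite (inj_eq (addrI _)); case: ifP; rewrite ?mulr0.
Qed.

(** The product equals its own component, which is [a] times the component of [p]; then [a]
    cancels. *)
Lemma homogz_cancel i j a p :
  a != 0 -> a \is i.-homog -> homogz (i%:Z + j) (a * p) -> homogz j p.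
Proof.
move=> a0 ha /pihomogz_id; rewrite pihomogzM // => /(mulfI a0) <-.
exact: pihomogzP.
Qed.

Lemma linear_formE a : a \is 1.-homog -> a = \sum_(t < 3) a@_U_(t) *: 'X_t.
Proof.
move=> ha; apply/mpolyP => m; rewrite raddf_sum /=.
have [/mdeg1P [t /eqP ->]|ne] := boolP (mdeg m == 1%N).
  rewrite (bigD1 t) //= mcoeffZ mcoeffX eqxx mulr1 big1 ?addr0 // => s st.
  by rewrite mcoeffZ mcoeffXU (negPf st) mulr0.
rewrite (dhomog_nemf_coeff ha ne) big1 // => t _.
rewrite mcoeffZ mcoeffX; case: eqP => [e|]; last by rewrite mulr0.
by rewrite -e mdeg1 in ne.
Qed.

Lemma mderiv_homog i t p : p \is i.+1.-homog -> p^`M(t) \is i.-homog.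
Proof.
move=> hp; apply/dhomogP => m; rewrite mcoeff_msupp mcoeff_deriv => nz.
have : p@_(m + U_(t)) != 0 by apply: contraNneq nz => ->; rewrite mul0rn.
apply: contra_neq_eq => ne; apply: dhomog_nemf_coeff hp _.
by rewrite /= mdegD mdeg1 addn1 eqSS.
Qed.

Lemma dhomogXn (t : 'I_3) n : ('X_t ^+ n : poly3 K) \is n.-homog.
Proof. by rewrite -[n in n.-homog]mul1n dhomogMn // dhomogX /= mdeg1. Qed.

(** Supports are compared: multiplying by a power of ['X_l] leaves the exponents of ['X_j]
    unchanged, so every monomial of [u] already carries ['X_j ^+ n]. *)
Lemma dvd_pow_coprime (j l : 'I_3) (m n : nat) (u w : poly3 K) : j != l ->
  'X_l ^+ m * u = 'X_j ^+ n * w -> exists r, u = 'X_j ^+ n * r.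
Proof.
move=> jl; rewrite !mpolyXn mulrC [RHS]mulrC => e.
suff le_n k : k \in msupp u -> (U_(j) *+ n <= k)%MM.
  exists (\sum_(k <- msupp u) u@_k *: 'X_[k - U_(j) *+ n]).
  rewrite {1}[u]mpolyE mulr_sumr big_seq [RHS]big_seq; apply: eq_bigr => k ku.
  by rewrite -scalerAr -mpolyXD addmC submK ?le_n.
move=> ku; have : (U_(l) *+ m + k)%MM \in msupp (w * 'X_[U_(j) *+ n]).
  by rewrite -e mcoeff_msupp mcoeffMX -mcoeff_msupp.
rewrite (perm_mem (msuppMX _ _)) => /mapP [k' _ /mnmP kE].
apply/mnm_lepP => t; rewrite mulmnE mnm1E; case: eqP => // <-.
have := kE j.
rewrite !mnmDE !mulmnE !mnm1E eqxx eq_sym (negPf jl) mul0n add0n mul1n => ->.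
exact: leq_addr.
Qed.

End Homogeneous.

Lemma big_ord3 (T : Type) (idx : T) (op : Monoid.com_law idx) (F : 'I_3 -> T)
    (i j l : 'I_3) : i != j -> i != l -> j != l ->
  \big[op/idx]_t F t = op (F i) (op (F j) (F l)).
Proof.
move=> ij il jl.
rewrite (bigD1 i) //= (bigD1 j) 1?eq_sym //= (bigD1 l) /=; last first.
  by rewrite eq_sym il eq_sym jl.
rewrite big1 ?Monoid.mulm1 // => t /andP [/andP [ti tj] tl].
(* A further index would give four distinct elements of a set of three. *)
suff : (size [:: t; i; j; l] <= #|'I_3|)%N by rewrite card_ord.
rewrite -(card_uniqP _) ?max_card //= !inE !negb_or ti tj tl ij il jl //.
Qed.

(** * The coordinate ring of the line, by elimination of one variable *)

Section Coordinates.
Variables (K : fieldType) (alpha : poly3 K) (i j l : 'I_3).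
Hypotheses (alpha_lin : alpha \is 1.-homog) (ai : alpha@_U_(i) != 0).
Hypotheses (ij : i != j) (il : i != l) (jl : j != l).
Implicit Types (p q : poly3 K).

(** Solves [alpha = 0] for ['X_i]. The quotient by [alpha] is thus realized inside the polynomial
    ring itself, as the polynomials in ['X_j] and ['X_l]. *)
Definition line_subst : 3.-tuple (poly3 K) :=
  [tuple if t == i then
     - (alpha@_U_(i))^-1 *: (alpha@_U_(j) *: 'X_j + alpha@_U_(l) *: 'X_l)
   else 'X_t | t < 3].

Definition line_proj p : poly3 K := p \mPo line_subst.

HB.instance Definition _ := GRing.RMorphism.copy line_proj (comp_mpoly line_subst).

Lemma alphaE : alpha =
  alpha@_U_(i) *: 'X_i + (alpha@_U_(j) *: 'X_j + alpha@_U_(l) *: 'X_l).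
Proof. by rewrite {1}[alpha]linear_formE // (big_ord3 _ _ ij il jl). Qed.

Lemma coord_neq0 : alpha != 0.
Proof. by apply: contraNneq ai => ->; rewrite mcoeff0. Qed.

Lemma line_projX t : t != i -> line_proj 'X_t = 'X_t.
Proof.
by move=> ti; rewrite /line_proj comp_mpolyXU -tnth_nth tnth_mktuple (negPf ti).
Qed.

Lemma line_projZ c p : line_proj (c *: p) = c *: line_proj p.
Proof. exact: comp_mpolyZ. Qed.

Lemma line_projXi : line_proj 'X_i =
  - (alpha@_U_(i))^-1 *: (alpha@_U_(j) *: 'X_j + alpha@_U_(l) *: 'X_l).
Proof. by rewrite /line_proj comp_mpolyXU -tnth_nth tnth_mktuple eqxx. Qed.

Lemma line_proj_alpha : line_proj alpha = 0.
Proof.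
rewrite {1}alphaE !rmorphD /= !line_projZ line_projXi !line_projX 1?eq_sym //.
by rewrite scalerA mulrN divff // scaleN1r addNr.
Qed.

(** The property is stable under sums and products, so only the variables matter, and only ['X_i] is
    moved. *)
Lemma line_proj_mod p : exists q, p = line_proj p + alpha * q.
Proof.
have X t : exists q, 'X_t = line_proj 'X_t + alpha * q.
  have [->|ti] := eqVneq t i; last by exists 0; rewrite line_projX ?mulr0 ?addr0.
  exists ((alpha@_U_(i))^-1%:MP).
  rewrite line_projXi mulrC mul_mpolyC scaleNr addrC -scalerBr.
  by rewrite [X in _ *: (X - _)]alphaE addrK scalerA mulVf // scale1r.
have M p1 p2 : (exists q, p1 = line_proj p1 + alpha * q) ->
    (exists q, p2 = line_proj p2 + alpha * q) ->
    exists q, p1 * p2 = line_proj (p1 * p2) + alpha * q.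
  move=> [q1 e1] [q2 e2]; exists (line_proj p1 * q2 + q1 * p2).
  by rewrite rmorphM /= {1}e1 {1}e2; rewrite {3}e2; ring.
elim/mpolyind: p => [|c m p _ _ [q IH]].
  by exists 0; rewrite rmorph0 mulr0 addr0.
have [q' e'] : exists q, 'X_[m] = line_proj 'X_[m] + alpha * q.
  rewrite mpolyXE_id; elim/big_ind: _ => [||t _]; [|exact: M|].
    by exists 0; rewrite rmorph1 mulr0 addr0.
  elim: (m t) => [|n IHn]; first by exists 0; rewrite expr0 rmorph1 mulr0 addr0.
  by rewrite exprS; apply: M.
exists (c *: q' + q); rewrite rmorphD /= line_projZ {1}IH {1}e'.
rewrite scalerDr mulrDr -!addrA -scalerAr; congr (_ + _).
by rewrite addrCA.
Qed.

Lemma line_proj_eq0 p : line_proj p = 0 <-> exists q, p = alpha * q.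
Proof.
split=> [p0|[q ->]]; last by rewrite rmorphM /= line_proj_alpha mul0r.
by have [q] := line_proj_mod p; rewrite p0 add0r; exists q.
Qed.

Lemma line_proj_homog n p : p \is n.-homog -> line_proj p \is n.-homog.
Proof.
move=> hp; rewrite [p]mpolyE raddf_sum /= big_seq; apply: rpred_sum => m mp.
rewrite line_projZ; apply: rpredZ; rewrite -(dhomog_mf hp mp) /=.
rewrite mpolyXE_id rmorph_prod /= mdegE.
apply: (big_ind2 (fun q e => q \is e.-homog)) => [|p1 n1 p2 n2|t _].
- exact: dhomog1.
- exact: dhomogM.
rewrite rmorphXn /= -[X in X.-homog]mul1n; apply: dhomogMn.
have [->|ti] := eqVneq t i; last by rewrite line_projX // dhomogX /= mdeg1.
by rewrite line_projXi rpredZ // rpredD // rpredZ // dhomogX /= mdeg1.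
Qed.

Lemma line_proj_homogz n p : homogz n p -> homogz n (line_proj p).
Proof.
by case: n => n /=; [exact: line_proj_homog | move=> ->; rewrite rmorph0].
Qed.

(* Descends on the exponent of 'X_i, which is a combination of alpha, 'X_j and
   'X_l. *)
Lemma regular_power_mem (I : poly3 K -> Prop) (a b : nat) :
  I 0 -> (forall p q, I p -> I q -> I (p + q)) ->
  (forall p q, I q -> I (p * q)) ->
  I alpha -> I ('X_j ^+ a) -> I ('X_l ^+ b) ->
  forall n p, (a + b <= n)%N -> p \is n.-homog -> I p.
Proof.
move=> I0 ID IM Ial Ij Il n p le_n hp.
have IZ c q : I q -> I (c *: q) by rewrite -mul_mpolyC; apply: IM.
have mon x y z : (a + b <= x + y + z)%N -> I ('X_i ^+ x * ('X_j ^+ y * 'X_l ^+ z)).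
  elim: x y z => [|x IH] y z le_xyz.
    (* Without ['X_i], the pigeonhole principle gives [a <= y] or [b <= z]. *)
    rewrite expr0 mul1r; have [le_ay|lt_ya] := leqP a y.
      by rewrite -(subnK le_ay) exprD mulrC mulrA; apply: IM.
    have le_bz : (b <= z)%N.
      by rewrite -(leq_add2l a) (leq_trans le_xyz) // add0n leq_add2r ltnW.
    by rewrite -(subnK le_bz) exprD mulrA; apply: IM.
  have Xi : 'X_i = (alpha@_U_(i))^-1 *:
      (alpha + - 1 *: (alpha@_U_(j) *: 'X_j + alpha@_U_(l) *: 'X_l)).
    by rewrite scaleN1r [X in _ *: (X - _)]alphaE addrK scalerA mulVf // scale1r.
  rewrite exprS {1}Xi -!scalerAl !mulrDl; apply: (IZ); apply: (ID).
    by rewrite -mulrA mulrC; apply: IM.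
  rewrite -!scalerAl; apply: (IZ); rewrite !mulrDl; apply: (ID).
    rewrite -!scalerAl; apply: (IZ).
    have := IH y.+1 z; rewrite addnS => /(_ le_xyz).
    by congr (I _); rewrite exprS; ring.
  rewrite -!scalerAl; apply: (IZ).
  have := IH y z.+1; rewrite addnS => /(_ le_xyz).
  by congr (I _); rewrite exprS; ring.
rewrite [p]mpolyE big_seq; apply: (big_ind I) => // m mp.
apply: (IZ); rewrite mpolyXE_id (big_ord3 _ _ ij il jl); apply: mon.
have : mdeg m = n := dhomog_mf hp mp.
by rewrite mdegE (big_ord3 _ _ ij il jl) /= addnA => ->.
Qed.

End Coordinates.

(** * Sections over principal opens, and transport of glued pairs along isomorphisms *)

Section Sections.
Variable K : fieldType.
Implicit Types (M N : grmod K) (g h : poly3 K) (c : poly3 K * nat).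

Lemma nullN M j (v : M) : null j v -> null j (- v).
Proof. by move=> nv; rewrite -sub0r; apply: nullB nv; apply: null0. Qed.

Lemma nullD M j (u v : M) : null j u -> null j v -> null j (u + v).
Proof. by move=> nu nv; rewrite -[v]opprK; apply: nullB nu (nullN nv). Qed.

Lemma pdegM g h : principal g -> principal h -> pdeg (g * h) = (pdeg g + pdeg h)%N.
Proof.
move=> [g0 _ hg] [h0 _ hh]; have hgh := dhomogM hg hh.
by apply: (dhomog_uniq _ (dhomog_msize hgh) hgh); rewrite mulf_neq0.
Qed.

Lemma principalM g h : principal g -> principal h -> principal (g * h).
Proof.
move=> pg ph; have [[g0 g1 hg] [h0 _ hh]] := (pg, ph).
by split; rewrite ?mulf_neq0 // pdegM ?addn_gt0 ?g1 // dhomogM.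
Qed.

Lemma dhomog_pdegX g n : principal g -> g ^+ n \is (n * pdeg g)%N.-homog.
Proof. by case=> _ _ hg; rewrite mulnC; apply: dhomogMn. Qed.

Lemma is_section_scale M g c (s : M * nat) :
  is_function g c -> is_section g s -> is_section g (scale_section c s).
Proof. by move=> hc hs; rewrite /is_section /= mulnDl PoszD; apply: pieceZ. Qed.

Lemma is_section_res M g h (s : M * nat) : principal g -> principal h ->
  is_section g s -> is_section (g * h) (res_section h s).
Proof.
move=> pg ph hs; rewrite /is_section pdegM //= mulnDr addnC PoszD.
by apply: pieceZ hs; apply: dhomog_pdegX.
Qed.

Lemma eq_section_sym M g (s t : M * nat) : eq_section g s t -> eq_section g t s.
Proof.
by move=> [k e]; exists k; rewrite addnC [(t.2 + _)%N]addnC addnC -opprB scalerN;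
  apply: nullN.
Qed.

Lemma nullXZ M g n a (v : M) : principal g ->
  null (a * pdeg g)%N v -> null ((n + a) * pdeg g)%N (g ^+ n *: v).
Proof. by move=> pg; rewrite mulnDl PoszD; apply: nullZ (dhomog_pdegX n pg). Qed.

(** The first relation times [g ^+ (m + u.2)] and the second times [g ^+ (k + s.2)] are added; the
    terms in [t] cancel. *)
Lemma eq_section_trans M g (t s u : M * nat) : principal g ->
  eq_section g s t -> eq_section g t u -> eq_section g s u.
Proof.
move=> pg [k e1] [m e2]; exists (k + m + t.2)%N.
have := nullD (nullXZ (m + u.2) pg e1)
  (eq_ind _ (fun n => null (n * pdeg g)%N _) (nullXZ (k + s.2) pg e2) _ _).
rewrite !scalerBr !scalerA -!exprD.
have -> : (k + s.2 + m + u.2 = m + u.2 + k + s.2)%N by lia.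
rewrite addrA subrK.
have -> : (m + u.2 + k + t.2 = k + m + t.2 + u.2)%N by lia.
have -> : (k + s.2 + m + t.2 = k + m + t.2 + s.2)%N by lia.
have -> : (m + u.2 + (k + (s.2 + t.2)) = k + m + t.2 + (s.2 + u.2))%N by lia.
by apply; lia.
Qed.

Lemma eq_section_scale M g c (s t : M * nat) : principal g -> is_function g c ->
  eq_section g s t -> eq_section g (scale_section c s) (scale_section c t).
Proof.
move=> pg hc [k e]; exists k.
have := nullZ (dhomogM hc (dhomog_pdegX c.2 pg)) e.
rewrite -PoszD -!mulnDl /=.
have -> : (c.2 + c.2 + (k + (s.2 + t.2)) = k + (c.2 + s.2 + (c.2 + t.2)))%N.
  by lia.
by congr (null _ _); rewrite !scalerBr !scalerA; congr (_ *: _ - _ *: _);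
  rewrite exprD; ring.
Qed.

(* Together with s on D(g) and t on D(h), the functions c1 and c2 on the overlap
   play the role of a transition cocycle: s and t glue to a section of a twist
   of M. *)
Definition glued M g h (c1 c2 : poly3 K * nat) (s t : M * nat) : Prop :=
  eq_section (g * h) (scale_section c1 (res_section g t))
                     (scale_section c2 (res_section h s)).

(** Zero is written as the scalar 0 times [s], so that compatibility of morphisms with scalars
    transports it. *)
Definition zero_section M g (s : M * nat) : Prop :=
  eq_section g s (scale_section (0, 0%N) s).

Definition has_section M g h c1 c2 : Prop :=
  exists s t : M * nat, [/\ is_section g s, is_section h t,
    glued g h c1 c2 s t & ~ zero_section g s].

Lemma sheaf_iso_sym M N : sheaf_iso M N -> sheaf_iso N M.
Proof. by move=> [phi [psi [? ? ? ?]]]; exists psi, phi; split. Qed.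

Lemma is_function0 g : is_function g (0, 0%N).
Proof. exact: rpred0. Qed.

Lemma glued_hom M N phi g h c1 c2 s t :
  sheaf_hom (M := M) (N := N) phi -> principal g -> principal h ->
  is_function (g * h) c1 -> is_function (g * h) c2 ->
  is_section g s -> is_section h t ->
  glued g h c1 c2 s t -> glued g h c1 c2 (phi g s) (phi h t).
Proof.
move=> H pg ph h1 h2 hs ht e.
have pgh := principalM pg ph; have pt := hom_section H pgh; rewrite /glued.
have rs := is_section_res pg ph hs.
have rt : is_section (g * h) (res_section g t).
  by rewrite mulrC; apply: is_section_res.
have et : eq_section (g * h) (phi (g * h) (res_section g t))
    (res_section g (phi h t)) by rewrite mulrC; apply: (hom_res H).
have es := hom_res H pg ph hs.
apply: (eq_section_trans pgh (eq_section_scale pgh h1 (eq_section_sym et))).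
apply: (eq_section_trans pgh (eq_section_sym (hom_scale H pgh h1 rt))).
apply: eq_section_trans (eq_section_scale pgh h2 es) => //.
apply: eq_section_trans (hom_scale H pgh h2 rs) => //.
by apply: (hom_eq H) e => //; apply: is_section_scale.
Qed.

Lemma has_section_iso M N g h c1 c2 : sheaf_iso M N ->
  principal g -> principal h -> is_function (g * h) c1 -> is_function (g * h) c2 ->
  has_section M g h c1 c2 -> has_section N g h c1 c2.
Proof.
move=> [phi [psi [H1 H2 K1 _]]] pg ph h1 h2 [s [t [hs ht e nz]]].
exists (phi g s), (phi h t); split; [exact: hom_section H1 _ _ pg hs| | |].
- exact: hom_section H1 _ _ ph ht.
- exact: glued_hom.
(* If the image of [s] were zero, applying the inverse [psi] would make [s] zero. *)
move=> z; apply: nz; have hz := is_section_scale (is_function0 g) hs.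
have pz := eq_section_trans pg z (eq_section_sym (hom_scale H1 pg (is_function0 g) hs)).
apply: (eq_section_trans pg (eq_section_sym (K1 g s pg hs))).
apply: (eq_section_trans pg _ (K1 g _ pg hz)).
by apply: (hom_eq H2) pz => //; apply: hom_section H1 _ _ pg _.
Qed.

End Sections.

(** * Twisted sections on the line as equations between polynomials *)

Section Line.
Variables (K : fieldType) (alpha : poly3 K) (i j l : 'I_3).
Hypotheses (alpha_lin : alpha \is 1.-homog) (ai : alpha@_U_(i) != 0).
Hypotheses (ij : i != j) (il : i != l) (jl : j != l).
Implicit Types (M : grmod K) (g h a : poly3 K).
Local Notation sg := (line_proj alpha i j l).

Lemma principalX t : principal ('X_t : poly3 K).
Proof.
have X0 : ('X_t : poly3 K) != 0.
  by apply/eqP => /mpolyP /(_ U_(t)%MM) /eqP; rewrite mcoeffXU eqxx mcoeff0 oner_eq0.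
have hX : ('X_t : poly3 K) \is 1.-homog by rewrite dhomogX /= mdeg1.
by have e := dhomog_uniq X0 (dhomog_msize hX) hX; split; rewrite // /pdeg e.
Qed.

Lemma pdegX t : pdeg ('X_t : poly3 K) = 1%N.
Proof.
have [X0 _ hX] := principalX t; apply: dhomog_uniq X0 hX _.
by rewrite dhomogX /= mdeg1.
Qed.

Lemma X_neq0 t : ('X_t : poly3 K) != 0.
Proof. by case: (principalX t). Qed.

(* The family tau is linear over the projection to the homogeneous coordinate
   ring of the line and jointly faithful, which turns equality of sections into
   equalities of polynomials. *)
Record detected M (I : Type) (tau : I -> M -> poly3 K) : Prop := Detected {
  detectB : forall t u v, tau t (u - v) = tau t u - tau t v;
  detectZ : forall t a v, tau t (a *: v) = sg a * tau t v;
  detect_null : forall n v, piece n v -> (null n v <-> forall t, tau t v = 0)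
}.

Section Detected.
Variables (M : grmod K) (I : Type) (tau : I -> M -> poly3 K).
Hypothesis tauP : detected tau.

(** The images under [tau] lie in a domain where [g] stays nonzero, so the auxiliary power [g ^+ k]
    cancels. *)
Lemma eq_sectionP g (s u : M * nat) : principal g -> sg g != 0 ->
  is_section g s -> is_section g u ->
  (eq_section g s u <->
   forall t, sg g ^+ u.2 * tau t s.1 = sg g ^+ s.2 * tau t u.1).
Proof.
move=> pg g0 hs hu.
have pX n m (v : M) : piece (m * pdeg g)%N v ->
    piece ((n + m) * pdeg g)%N (g ^+ n *: v).
  by rewrite mulnDl PoszD; apply: pieceZ; apply: dhomog_pdegX.
have E k : null ((k + (s.2 + u.2)) * pdeg g)%N
    (g ^+ k *: (g ^+ u.2 *: s.1 - g ^+ s.2 *: u.1)) <->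
  forall t, sg g ^+ u.2 * tau t s.1 = sg g ^+ s.2 * tau t u.1.
  rewrite (detect_null tauP); last first.
    apply: (pX); apply: pieceB; last exact: (pX).
    by rewrite addnC; apply: (pX).
  have tE t : tau t (g ^+ k *: (g ^+ u.2 *: s.1 - g ^+ s.2 *: u.1)) =
      sg g ^+ k * (sg g ^+ u.2 * tau t s.1 - sg g ^+ s.2 * tau t u.1).
    by rewrite (detectZ tauP) (detectB tauP) !(detectZ tauP) !rmorphXn.
  split=> H t; last by rewrite tE H subrr mulr0.
  have /eqP := H t.
  by rewrite tE mulf_eq0 expf_eq0 (negPf g0) andbF /= subr_eq0 => /eqP.
by split=> [[k /E]|/(E 0%N)] //; exists 0%N.
Qed.

Lemma zero_sectionP g (s : M * nat) : principal g -> sg g != 0 ->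
  is_section g s -> (zero_section g s <-> forall t, tau t s.1 = 0).
Proof.
move=> pg g0 hs; rewrite /zero_section.
rewrite eq_sectionP // /=; last by apply: is_section_scale => //; exact: is_function0.
split=> H t; last by rewrite (detectZ tauP) H !mulr0.
apply/eqP; have /eqP := H t; rewrite (detectZ tauP) rmorph0 mul0r mulr0.
by rewrite mulf_eq0 expf_eq0 (negPf g0) andbF.
Qed.

End Detected.

(* The cocycle of the twist by p - q on the cover by 'X_j and 'X_l; the common
   factor 'X_j ^+ (p + q) brings the numerators to the degree of
   ('X_j * 'X_l) ^+ (p + q). *)
Definition twist_fun (s t : 'I_3) (p q : nat) : poly3 K * nat :=
  ('X_s ^+ p * 'X_t ^+ q * 'X_j ^+ (p + q), (p + q)%N).

Definition has_twisted_section M p q : Prop :=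
  has_section M 'X_j 'X_l (twist_fun l j p q) (twist_fun j l p q).

Lemma is_function_twist s t p q : is_function ('X_j * 'X_l) (twist_fun s t p q).
Proof.
rewrite /is_function /= (pdegM (principalX j) (principalX l)) !pdegX muln2 -addnn.
by apply: dhomogM; [apply: dhomogM|]; exact: dhomogXn.
Qed.

Lemma has_twisted_section_iso M N p q : sheaf_iso M N ->
  has_twisted_section M p q -> has_twisted_section N p q.
Proof.
move=> MN; apply: has_section_iso MN _ _ _ _; try exact: principalX.
all: exact: is_function_twist.
Qed.

(** The equation says that the fractions ['X_j ^+ p * s.1 / 'X_j ^+ (s.2 + q)] and
    ['X_l ^+ p * t.1 / 'X_l ^+ (t.2 + q)], of degree [p - q], agree on the line. *)
Lemma has_twisted_sectionP M (I : Type) (tau : I -> M -> poly3 K) p q :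
  detected tau ->
  has_twisted_section M p q <->
  exists s t : M * nat, [/\ piece s.2 s.1, piece t.2 t.1,
    forall e, 'X_j ^+ (s.2 + q) * 'X_l ^+ p * tau e t.1 =
              'X_l ^+ (t.2 + q) * 'X_j ^+ p * tau e s.1 &
    ~ forall e, tau e s.1 = 0].
Proof.
move=> tauP.
have ji : j != i by rewrite eq_sym.
have li : l != i by rewrite eq_sym.
have [pj pl] := (principalX j, principalX l); have pjl := principalM pj pl.
have sj : sg 'X_j != 0 by rewrite line_projX ?X_neq0.
have sjl : sg ('X_j * 'X_l) != 0 by rewrite rmorphM /= !line_projX // mulf_neq0 ?X_neq0.
have secX u (s : M * nat) : is_section 'X_u s <-> piece s.2 s.1.
  by rewrite /is_section pdegX muln1.
have E (s t : M * nat) : is_section 'X_j s -> is_section 'X_l t ->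
    glued 'X_j 'X_l (twist_fun l j p q) (twist_fun j l p q) s t <->
    forall e, 'X_j ^+ (s.2 + q) * 'X_l ^+ p * tau e t.1 =
              'X_l ^+ (t.2 + q) * 'X_j ^+ p * tau e s.1.
  move=> hs ht; rewrite /glued (eq_sectionP tauP) //; first last.
  - by apply: is_section_scale; [exact: is_function_twist|exact: is_section_res].
  - apply: is_section_scale; first exact: is_function_twist.
    by rewrite mulrC; apply: is_section_res.
  (* [D] is the common nonzero factor by which the gluing condition exceeds the stated equation. *)
  pose D : poly3 K := ('X_j * 'X_l) ^+ (p + q) * 'X_j ^+ (p + q) *
    ('X_j ^+ t.2 * 'X_l ^+ s.2).
  have D0 : D != 0 by rewrite !mulf_neq0 ?expf_neq0 ?mulf_neq0 ?X_neq0.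
  suff eD e : (sg ('X_j * 'X_l) ^+ (p + q + s.2) *
      tau e ('X_l ^+ p * 'X_j ^+ q * 'X_j ^+ (p + q) *: ('X_j ^+ t.2 *: t.1)) =
    D * ('X_j ^+ (s.2 + q) * 'X_l ^+ p * tau e t.1)) *
    (sg ('X_j * 'X_l) ^+ (p + q + t.2) *
      tau e ('X_j ^+ p * 'X_l ^+ q * 'X_j ^+ (p + q) *: ('X_l ^+ s.2 *: s.1)) =
    D * ('X_l ^+ (t.2 + q) * 'X_j ^+ p * tau e s.1)).
    split=> H e; last by rewrite /= !eD H.
    by apply: (mulfI D0); have := H e; rewrite /= !eD.
  rewrite !(detectZ tauP) !rmorphM !rmorphXn /= !line_projX // /D !exprD !exprMn.
  by split; ring.
split=> -[s [t [hs ht e nz]]]; exists s, t.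
  split; [exact: (secX j s).1|exact: (secX l t).1|exact: (E s t hs ht).1|].
  by move=> z; apply: nz; apply: (zero_sectionP tauP pj sj hs).2.
have [hs' ht'] := ((secX j s).2 hs, (secX l t).2 ht).
split=> //; first exact: (E s t hs' ht').2.
by move=> /(zero_sectionP tauP pj sj hs').1.
Qed.

(** If all coordinates of a syzygy vanish on the line, it is [alpha *: w], and [w] is again a syzygy
    because [alpha] cancels. *)
Lemma detected_AR f :
  @detected (restr alpha (AR f)) 'I_3 (fun t (v : 'rV[poly3 K]_3) => sg (v 0 t)).
Proof.
split=> [t u v|t a v|n v pv]; first by rewrite !mxE rmorphB.
  by rewrite mxE rmorphM.
split=> [[_ [w _ /= /subr0_eq ->]] t|z].
  by rewrite mxE rmorphM /= line_proj_alpha // mul0r.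
have a0 := coord_neq0 ai.
have /choice [q vq] t : exists q, v 0 t = alpha * q.
  exact/(line_proj_eq0 alpha_lin ai ij il jl).
pose w : 'rV[poly3 K]_3 := \row_t q t.
have vw : v = alpha *: w :> 'rV[poly3 K]_3 by apply/rowP => t; rewrite !mxE.
split=> //; exists w; last by rewrite /= vw subrr.
have [hv gv] := pv; split=> [t|].
  apply: (homogz_cancel a0 alpha_lin); have := hv t.
  by rewrite addrCA subrr addr0 vw mxE.
apply: (mulfI a0); by rewrite mulr0 -gv vw linearZ.
Qed.

Lemma detected_twists d1 d2 :
  @detected (dsum (restr alpha (twist K d1)) (restr alpha (twist K d2))) bool
    (fun b (v : poly3 K * poly3 K) => sg (if b then v.1 else v.2)).
Proof.
have a0 := coord_neq0 ai.
have one d n (x : poly3 K) : homogz (n - d) x ->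
    @null K (restr alpha (twist K d)) n x <-> sg x = 0.
  move=> hx; split=> [[_ [w _ /= /subr0_eq ->]]|].
    by rewrite rmorphM /= line_proj_alpha // mul0r.
  move=> /(line_proj_eq0 alpha_lin ai ij il jl) [q xq]; split=> //.
  exists q; last by rewrite /= xq subrr.
  apply: (homogz_cancel a0 alpha_lin); rewrite -xq.
  by have -> : 1%N%:Z + (n - 1 - d) = n - d by lia.
split=> [b u v|b a v|n v [p1 p2]].
- by case: b; rewrite /= rmorphB.
- by case: b; rewrite /= rmorphM.
split=> [[n1 n2] b|z]; first by case: b; [apply: (one _ _ _ p1).1|apply: (one _ _ _ p2).1].
by split; [apply/(one _ _ _ p1)/(z true)|apply/(one _ _ _ p2)/(z false)].
Qed.

End Line.

(** * Homogeneous cofactors in the Jacobian ideal and the kernel of multiplication by [alpha] *)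

Section JacobianSyzygies.
Variables (K : fieldType) (d : nat) (f : poly3 K).
Hypotheses (d_gt0 : (0 < d)%N) (f_homog : f \is d.-homog).

Lemma partial_homog t : f^`M(t) \is (d.-1).-homog.
Proof. by apply: mderiv_homog; rewrite prednK. Qed.

Lemma dotgrad_homogz n (v : 'rV[poly3 K]_3) : (forall e, homogz n (v 0 e)) ->
  homogz (n + d%:Z - 1) (dotgrad f v).
Proof.
move=> hv; rewrite /dotgrad; apply: (big_ind (homogz _)) => [|x y hx hy|e _].
- exact: homogz0.
- rewrite -[y]opprK -[- y]sub0r; apply: homogzB => //.
  by apply: homogzB hy; exact: homogz0.
have -> : n + d%:Z - 1 = d.-1%:Z + n by lia.
by rewrite mulrC; apply: homogzM => //; exact: partial_homog.
Qed.

(** The partial derivatives have degree [d - 1], so the components of degree [n - (d - 1)] of any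
    cofactors suffice. *)
Lemma jacobian_homogz n p : homogz n p -> jacobian f p ->
  exists v : 'rV[poly3 K]_3,
    p = dotgrad f v /\ forall e, homogz (n - d%:Z + 1) (v 0 e).
Proof.
move=> hp [v pv]; exists (\row_e pihomogz (n - d%:Z + 1) (v 0 e)); split; last first.
  by move=> e; rewrite mxE; exact: pihomogzP.
rewrite -(pihomogz_id hp) pv /dotgrad.
rewrite (big_morph (pihomogz n) (@pihomogzD K n) (pihomogz_id (homogz0 K n))).
apply: eq_bigr => e _; rewrite mxE mulrC [RHS]mulrC.
have {1}-> : n = d.-1%:Z + (n - d%:Z + 1) by lia.
by apply: pihomogzM; exact: partial_homog.
Qed.

Variable alpha : poly3 K.
Hypothesis alpha_lin : alpha \is 1.-homog.

Lemma mul_not_injectiveP n : ~ mul_injective (jacobian_module f) alpha n <->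
  exists p, [/\ homogz n p, jacobian_sat f p, jacobian f (alpha * p)
    & ~ jacobian f p].
Proof.
split=> [ninj|[p [hp sp ap np]] inj].
  apply: contrapT => H; apply: ninj => u v [hu su] [hv sv] [_ auv].
  have huv := homogzB hu hv; split=> //; apply: contrapT => nj.
  apply: H; exists (u - v); split=> //; first exact: jacobian_satB.
  by rewrite mulrBr.
have n0 : piece n (0 : jacobian_module f) by apply: null_piece; exact: null0.
have := inj p 0 (conj hp sp) n0; rewrite subr0 => -[|_ //].
rewrite scaler0 subr0; split=> //; rewrite addrC.
exact: homogzM alpha_lin hp.
Qed.

Lemma jacobian_kernel_syzygy (k : int) P : homogz (k + d%:Z - 2) P ->
  jacobian f (alpha * P) ->
  exists r : 'rV[poly3 K]_3,
    alpha * P = dotgrad f r /\ forall e, homogz k (r 0 e).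
Proof.
move=> hP JaP; have := homogzM alpha_lin hP.
have -> : 1%N%:Z + (k + d%:Z - 2) = k + d%:Z - 1 by lia.
move=> haP; have [r [rE hr]] := jacobian_homogz haP JaP; exists r; split=> // e.
by have := hr e; congr homogz; lia.
Qed.

Hypothesis alpha_neq0 : alpha != 0.

(** Cofactors of [alpha * P] have degree [k]; for negative [k] they vanish, hence so does [P]. *)
Lemma mul_not_injective_ge0 (k : int) :
  ~ mul_injective (jacobian_module f) alpha (k + d%:Z - 2) -> 0 <= k.
Proof.
move=> /mul_not_injectiveP [P [hP _ JaP nJ]]; rewrite leNgt; apply/negP => k0.
have [r [rE hr]] := jacobian_kernel_syzygy hP JaP; apply: nJ.
suff -> : P = 0 by exists 0; rewrite linear0.
apply: (mulfI alpha_neq0); rewrite rE mulr0 (_ : r = 0) ?linear0 //.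
by apply/rowP => e; rewrite mxE; apply: homogz_lt0 k0 (hr e).
Qed.

End JacobianSyzygies.

Lemma min_natP (P : nat -> Prop) :
  (min_nat P = +oo%E /\ forall n, ~ P n) \/
  exists n, [/\ min_nat P = n%:Z%:E, P n & forall m, P m -> (n <= m)%N].
Proof.
rewrite /min_nat; case: pselect => [exP|nex]; [right|left].
  case: ex_minnP => n /asboolP Pn min; exists n; split=> // m Pm.
  by apply: min; apply/asboolP.
by split=> // n Pn; apply: nex; exists n; apply/asboolP.
Qed.

(** * Existence of twisted sections on both sides of the splitting *)

Section Curves.
Variables (K : fieldType) (alpha : poly3 K) (i j l : 'I_3).
Hypotheses (alpha_lin : alpha \is 1.-homog) (ai : alpha@_U_(i) != 0).
Hypotheses (ij : i != j) (il : i != l) (jl : j != l).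
Local Notation sg := (line_proj alpha i j l).

Lemma coord_neq : (j != i) * (l != i).
Proof. by rewrite eq_sym ij eq_sym il. Qed.

(** After the twist the first summand becomes trivial, and the section is its constant 1, written
    ['X_j ^+ (p + q) / 'X_j ^+ (p + q)]. *)
Lemma twists_section p q (d1 d2 : int) : d1 = p%:Z - q%:Z ->
  has_twisted_section j l
    (dsum (restr alpha (twist K d1)) (restr alpha (twist K d2))) p q.
Proof.
move=> dE.
apply/(has_twisted_sectionP ij il _ _
  (detected_twists alpha_lin ai ij il jl d1 d2)).
have pq : p%:Z - d1 = q by lia.
exists (('X_j ^+ q, 0), p), (('X_l ^+ q, 0), p); split=> /=.
- by split; [rewrite pq; exact: dhomogXn|exact: homogz0].
- by split; [rewrite pq; exact: dhomogXn|exact: homogz0].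
- case; last by rewrite rmorph0 !mulr0.
  by rewrite !rmorphXn /= !line_projX ?coord_neq // !exprD; ring.
move=> /(_ true); rewrite rmorphXn /= line_projX ?coord_neq // => /eqP.
by rewrite expf_eq0 (negPf (X_neq0 _ _)) andbF.
Qed.

Lemma twists_no_section p q (d1 d2 : int) : p%:Z - q%:Z < d1 -> d1 <= d2 ->
  ~ has_twisted_section j l
    (dsum (restr alpha (twist K d1)) (restr alpha (twist K d2))) p q.
Proof.
move=> lt1 le12; rewrite (has_twisted_sectionP ij il _ _
  (detected_twists alpha_lin ai ij il jl d1 d2)).
have lt2 := lt_le_trans lt1 le12.
have one d (a b : nat) (x y : poly3 K) : p%:Z - q%:Z < d -> homogz (a%:Z - d) x ->
    'X_j ^+ (a + q) * 'X_l ^+ p * sg y = 'X_l ^+ (b + q) * 'X_j ^+ p * sg x ->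
    sg x = 0.
  move=> ltd hx e; have hsx := line_proj_homogz alpha i j l hx.
  have [lt_a|le_a] := ltP (a%:Z - d) 0; first exact: homogz_lt0 lt_a hsx.
  (* Gluing makes ['X_j ^+ n] divide [sg x], whose degree [a - d] is below [n = a + q - p]; this
     forces [sg x = 0]. *)
  have [n nE] : exists n, (a + q = p + n)%N by exists (a + q - p)%N; lia.
  have [r rE] : exists r, sg x = 'X_j ^+ n * r.
    apply: (@dvd_pow_coprime _ j l (b + q) n _ ('X_l ^+ p * sg y) jl).
    apply: (@mulfI _ ('X_j ^+ p)); first by rewrite expf_neq0 // X_neq0.
    by move: e; rewrite nE exprD => e; rewrite [LHS]mulrCA !mulrA -e; ring.
  rewrite rE in hsx *; suff -> : r = 0 by rewrite mulr0.
  have lt0 : a%:Z - d - n%:Z < 0 by lia.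
  apply: (homogz_lt0 lt0).
  apply: (homogz_cancel _ (dhomogXn _ j n)); first by rewrite expf_neq0 // X_neq0.
  by have -> : n%:Z + (a%:Z - d - n%:Z) = a%:Z - d by lia.
move=> [[[v1 v2] a] [[[w1 w2] b] [/= [h1 h2] _ e]]]; apply.
by case; [apply: one lt1 h1 (e true)|apply: one lt2 h2 (e false)].
Qed.

Variables (d : nat) (f : poly3 K).
Hypotheses (d_gt0 : (0 < d)%N) (f_homog : f \is d.-homog).

Lemma AR_section p q (k := p%:Z - q%:Z) :
  has_twisted_section j l (restr alpha (AR f)) p q ->
  (exists v : AR f, piece k v /\ v <> 0) \/
  ~ mul_injective (jacobian_module f) alpha (k + d%:Z - 2).
Proof.
move=> /(has_twisted_sectionP ij il _ _ (detected_AR alpha_lin ai ij il jl f)).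
move=> [[s a] [[t b] [/= [hs ds] [ht dt] e nz]]].
(* The two local sections after the twist are [V / 'X_j ^+ n] and [W / 'X_l ^+ m]. *)
pose n := (a + q)%N; pose m := (b + q)%N.
pose V : 'rV[poly3 K]_3 := 'X_j ^+ p *: s; pose W : 'rV[poly3 K]_3 := 'X_l ^+ p *: t.
have XV x : sg (V 0 x) = 'X_j ^+ p * sg (s 0 x).
  by rewrite mxE rmorphM rmorphXn /= line_projX // coord_neq.
have XW x : sg (W 0 x) = 'X_l ^+ p * sg (t 0 x).
  by rewrite mxE rmorphM rmorphXn /= line_projX // coord_neq.
have Xn0 u N : ('X_u ^+ N : poly3 K) != 0 by rewrite expf_neq0 // X_neq0.
have eVW x : 'X_l ^+ m * sg (V 0 x) = 'X_j ^+ n * sg (W 0 x).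
  by rewrite XV XW !mulrA e.
have /choice [r0 r0E] x : exists r, sg (V 0 x) = 'X_j ^+ n * r.
  exact: dvd_pow_coprime jl (eVW x).
pose r : 'rV[poly3 K]_3 := \row_x r0 x.
have rV x : sg (V 0 x) = 'X_j ^+ n * r 0 x by rewrite [r 0 x]mxE.
have rW x : sg (W 0 x) = 'X_l ^+ m * r 0 x.
  by apply: (mulfI (Xn0 j n)); rewrite -eVW rV mulrCA.
have hr x : homogz k (r 0 x).
  apply: (homogz_cancel (Xn0 j n) (dhomogXn _ j n)); rewrite -rV.
  apply: line_proj_homogz => //; have := @homogzM K p a%:Z _ _ (dhomogXn _ j p) (hs x).
  by rewrite mxE; congr homogz; rewrite /k /n; lia.
(* Equalities on the line are lifted to the plane at the cost of a multiple of [alpha]. *)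
have lift (U : 'rV[poly3 K]_3) y : (forall x, sg (U 0 x) = y * r 0 x) ->
    exists U', U = y *: r + alpha *: U'.
  move=> rU; have /choice [u uE] x := line_proj_mod alpha_lin ai ij il jl (U 0 x).
  by exists (\row_x u x); apply/rowP => x; rewrite !mxE {1}uE rU mxE.
have [[V' VE] [W' WE]] := (lift V _ rV, lift W _ rW).
have dV : dotgrad f V = 0 by rewrite linearZ /= ds scaler0.
have dW : dotgrad f W = 0 by rewrite linearZ /= dt scaler0.
have dr y U' : dotgrad f (y *: r + alpha *: U') = 0 ->
    y * dotgrad f r = alpha * dotgrad f (- U').
  by rewrite linearD !linearZ linearN /= mulrN => /eqP; rewrite addr_eq0 => /eqP.
have drV := dr _ _ (etrans (congr1 _ (esym VE)) dV).
have drW := dr _ _ (etrans (congr1 _ (esym WE)) dW).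
have a0 := coord_neq0 ai.
(* By [drV], ['X_j ^+ n * dotgrad f r] vanishes on the line, where ['X_j] is not zero. *)
have [P PE] : exists P, dotgrad f r = alpha * P.
  apply/(line_proj_eq0 alpha_lin ai ij il jl); apply: (mulfI (Xn0 j n)).
  have := congr1 sg drV; rewrite !rmorphM rmorphXn /= line_projX ?coord_neq //.
  by rewrite line_proj_alpha // mul0r mulr0.
have jV : 'X_j ^+ n * P = dotgrad f (- V').
  by apply: (mulfI a0); rewrite mulrCA -PE.
have jW : 'X_l ^+ m * P = dotgrad f (- W').
  by apply: (mulfI a0); rewrite mulrCA -PE.
have hP : homogz (k + d%:Z - 2) P.
  apply: (homogz_cancel a0 alpha_lin); rewrite -PE.
  have -> : 1%N%:Z + (k + d%:Z - 2) = k + d%:Z - 1 by lia.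
  by apply: dotgrad_homogz.
have [JP|nJP] := pselect (jacobian f P); [left|right].
  have [r' [Pr' hr']] := jacobian_homogz d_gt0 f_homog hP JP.
  exists (r - alpha *: r'); split; first split=> [x|].
  - rewrite !mxE; apply: homogzB; rewrite ?mxE //.
      by have := hr x; rewrite mxE.
    have -> : k = 1%N%:Z + (k + d%:Z - 2 - d%:Z + 1) by lia.
    exact: homogzM.
  - by rewrite linearB linearZ /= PE Pr' subrr.
  (* If [r] were [alpha *: r'], then [V], and with it the given section, would vanish on the
     line. *)
  move=> /subr0_eq rE; apply: nz => x; apply: (mulfI (Xn0 j p)).
  rewrite -XV VE rE !mxE rmorphD !rmorphM /= line_proj_alpha //.
  by rewrite !mul0r !mulr0 addr0.
apply/(mul_not_injectiveP _ alpha_lin); exists P; split=> //; last by exists r.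
(* Forms of degree at least [n + m] lie in the ideal generated by [alpha], ['X_j ^+ n] and
   ['X_l ^+ m], each of which multiplies [P] into the Jacobian ideal. *)
exists (n + m)%N => N x le_N hx.
apply: (regular_power_mem alpha_lin ai ij il jl (I := fun x => jacobian f (x * P))
  _ _ _ _ _ _ le_N hx).
- by rewrite mul0r; exists 0; rewrite linear0.
- by move=> y z [u yu] [v zv]; exists (u + v); rewrite mulrDl linearD /= yu zv.
- by move=> y z Jz; rewrite -mulrA; apply: jacobianM.
- by exists r.
- by exists (- V').
- by exists (- W').
Qed.

(** The global section is [v] itself. Were it zero on the line, [v] would be [alpha] times a syzygy
    of degree [k - 1]. *)
Lemma AR_section_of_syzygy (k : nat) (v : AR f) : piece k%:Z v -> v <> 0 ->
  (forall (w : AR f), piece (k%:Z - 1) w -> w = 0) ->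
  has_twisted_section j l (restr alpha (AR f)) k 0.
Proof.
move=> pv v0 min.
apply/(has_twisted_sectionP ij il _ _ (detected_AR alpha_lin ai ij il jl f)).
exists (v, k), (v, k); split=> //= [e|z].
  by rewrite addn0 [X in X * _]mulrC.
have [_ [w /min w0 /= vw]] := (detect_null (detected_AR alpha_lin ai ij il jl f) pv).2 z.
by apply: v0; move: vw; rewrite w0 scaler0 subr0.
Qed.

(** With [alpha * P = dotgrad f r] and ['X_t ^+ n * P = dotgrad f v], the vector
    ['X_t ^+ n *: r - alpha *: v] is a syzygy restricting to ['X_t ^+ n *: r]; the cases [t = j, l]
    glue to the section [r]. *)
Lemma AR_section_of_kernel (k : nat) :
  ~ mul_injective (jacobian_module f) alpha (k%:Z + d%:Z - 2) ->
  has_twisted_section j l (restr alpha (AR f)) k 0.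
Proof.
move=> /(mul_not_injectiveP _ alpha_lin) [P [hP [n sP] JaP nJ]].
have [r [rE hr]] := jacobian_kernel_syzygy d_gt0 f_homog alpha_lin hP JaP.
apply/(has_twisted_sectionP ij il _ _ (detected_AR alpha_lin ai ij il jl f)).
have lift t : t != i -> exists V : 'rV[poly3 K]_3,
    @piece K (AR f) (n + k)%N%:Z V /\
    forall e, sg (V 0 e) = 'X_t ^+ n * sg (r 0 e).
  move=> ti; have hXP := homogzM (dhomogXn _ t n) hP.
  have [v [vE hv]] := jacobian_homogz d_gt0 f_homog hXP (sP n _ (leqnn n) (dhomogXn _ t n)).
  exists ('X_t ^+ n *: r - alpha *: v); split; first split=> [e|].
  - rewrite !mxE; apply: homogzB; first exact: homogzM (dhomogXn _ t n) (hr e).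
    have -> : (n + k)%N%:Z = 1%N%:Z + (n%:Z + (k%:Z + d%:Z - 2) - d%:Z + 1) by lia.
    exact: homogzM.
  - by rewrite linearB !linearZ /= -vE -rE /GRing.scale /= mulrCA subrr.
  move=> e; rewrite !mxE rmorphB !rmorphM rmorphXn /= line_proj_alpha //.
  by rewrite mul0r subr0 line_projX.
have [V [pV eV]] := lift j coord_neq.1; have [W [pW eW]] := lift l coord_neq.2.
exists (V, n + k)%N, (W, n + k)%N; split=> //= [e|z].
  by rewrite eV eW !addn0 !exprD; ring.
(* If [V] vanished on the line, so would [r], and dividing [r] by [alpha] would put [P] in the
   Jacobian ideal. *)
have /choice [u uE] e : exists q, r 0 e = alpha * q.
  apply/(line_proj_eq0 alpha_lin ai ij il jl).
  by apply: (@mulfI _ ('X_j ^+ n)); rewrite ?expf_neq0 ?X_neq0 // -eV z mulr0.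
apply: nJ; exists (\row_e u e); apply: (mulfI (coord_neq0 ai)).
have -> : alpha * dotgrad f (\row_e u e) = dotgrad f (alpha *: \row_e u e).
  by rewrite linearZ.
by rewrite rE; congr dotgrad; apply/rowP => e; rewrite !mxE uE.
Qed.

End Curves.

(** * Comparison of the least twists having a nonzero section *)

Theorem proposition4p1 (R : realType) (d : nat) (f : {mpoly R[i][3]})
    (d_gt0 : (0 < d)%N) (f_neq0 : f != 0) (f_homog : f \is d.-homog)
    (f_reduced : reduced f) (mdr_ge1 : (1%:E <= mdr f)%E)
    (alpha : {mpoly R[i][3]})
    (alpha_neq0 : alpha != 0) (alpha_lin : alpha \is 1.-homog)
    (d1 d2 : int) (d1_d2 : splitting_type f alpha d1 d2) :
  d1%:E = Order.min (mdr f) (k_line d f alpha).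
Proof.
have [i ai] : exists i, alpha@_U_(i) != 0.
  apply: contrapT => nex; case/eqP: alpha_neq0.
  rewrite [alpha]linear_formE // big1 // => t _.
  rewrite (_ : alpha@_U_(t) = 0) ?scale0r //.
  by apply: contrapT => /eqP at0; apply: nex; exists t.
have [j [l [ij il jl]]] : exists j l : 'I_3, [/\ i != j, i != l & j != l].
  (* Addition in ['I_3] is modulo 3. *)
  by exists (i + 1), (i + 2%:R); move: i {ai} => [[|[|[|//]]] ?].
case: d1_d2 => le12 iso.
have upper (k : nat) :
    has_twisted_section j l (restr alpha (AR f)) k 0 -> d1 <= k%:Z.
  move=> /(has_twisted_section_iso iso) sec; rewrite leNgt; apply/negP => lt1.
  by apply: (twists_no_section alpha_lin ai ij il jl _ le12 sec); rewrite subr0.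
have mdr_upper : (d1%:E <= mdr f)%E.
  rewrite /mdr; set P := (X in min_nat X).
  case: (min_natP P) => [[-> _]|[k [-> [v [pv v0]] min]]].
    exact: leey.
  rewrite lee_fin; apply: upper.
  apply: (AR_section_of_syzygy alpha_lin ai ij il jl pv v0) => w pw.
  (* For [k = 0] the vector [w] has degree -1 and is zero; otherwise minimality of [k] applies. *)
  case: k {pv v0} min pw => [_ [hw _]|k min pw].
    by apply/rowP => e; rewrite mxE; exact: hw e.
  apply: contrapT => w0; suff : (k.+1 <= k)%N by rewrite ltnn.
  apply: min; exists w; split=> //; move: pw; congr piece; lia.
have kline_upper : (d1%:E <= k_line d f alpha)%E.
  rewrite /k_line; set P := (X in min_nat X).
  case: (min_natP P) => [[-> _]|[k [-> ninj _]]].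
    exact: leey.
  rewrite lee_fin; apply: upper.
  exact: (AR_section_of_kernel alpha_lin ai ij il jl d_gt0 f_homog ninj).
apply/eqP; rewrite eq_le le_min mdr_upper kline_upper /= ge_min.
have [p [q dE]] : exists p q : nat, d1 = p%:Z - q%:Z.
  by case: (d1) => n; [exists n, 0%N | exists 0%N, n.+1]; lia.
(* Both minima range over naturals, so [d1] must be shown nonnegative before it can bound one of
   them. *)
have min_le (P : nat -> Prop) : 0 <= d1 ->
    (forall k : nat, d1 = k%:Z -> P k) -> (min_nat P <= d1%:E)%E.
  case: (d1) => // n _ /(_ n erefl) Pn.
  case: (min_natP P) => [[_ /(_ n)] //|[m [-> _ /(_ _ Pn) le_mn]]].
  by rewrite lee_fin lez_nat.
(* The section in twist [d1] is carried back to the syzygy side, where it yields a syzygy or a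
   kernel element of the matching degree. *)
have := has_twisted_section_iso (sheaf_iso_sym iso)
  (twists_section alpha_lin ai ij il jl d2 dE).
move=> /(AR_section alpha_lin ai ij il jl d_gt0 f_homog); rewrite -dE.
case=> [[v [pv v0]]|ninj]; apply/orP; [left|right]; apply: min_le.
- rewrite leNgt; apply/negP => lt0; apply: v0; apply/rowP => e.
  by rewrite mxE; apply: homogz_lt0 lt0 (pv.1 e).
- by move=> k dk; exists v; split; rewrite -?dk.
- exact: (mul_not_injective_ge0 d_gt0 f_homog alpha_lin alpha_neq0 ninj).
- by move=> k <-.
Qed.
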